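(* Let $X=\{1,\ldots,K\}$, let $Y$ be a finite set, and let $h:D\to Y$. Suppose that for every $y\in Y$ the level set $L(y)=\{p\in D: h(p)=y\}$ is a finite union of sets, each of which is a finite intersection of sets of the form $\{p\in D:\alpha_1p_1+\cdots+\alpha_Kp_K\le\alpha\}$ or $\{p\in D:\alpha_1p_1+\cdots+\alpha_Kp_K<\alpha\}$ with rational coefficients $\alpha,\alpha_1,\ldots,\alpha_K$. Then $h$ is computable.
   Context: Model of computation. Let $X$ (initial values), $Y$ (outputs), $M$ (messages) be sets and, for each integer $d\ge 0$, let $Z_d$ be a set (memory states); each of $Y$, $M$, $Z_d$ contains a distinguished element $\emptyset$. An automaton family is a sequence of maps $(A_d)_{d\ge0}$, $A_d: X\times Z_d\times Y\times M^d\to X\times Z_d\times Y\times M^d$, which leave the first coordinate unchanged. A network is a finite connected simple undirected graph $G=(V,E)$ with $V=\{1,\ldots,n\}$, together with a port labeling: for each node $i$ of degree $d(i)$, a bijection $\ell_i$ from the set of neighbors of $i$ to $\{1,\ldots,d(i)\}$. Given initial values $x_1,\ldots,x_n\in X$, the execution is: node $i$ has state $S_i(t)=(x_i,z_i(t),y_i(t),m_{i,1}(t),\ldots,m_{i,d(i)}(t))$ with $z_i(0)=y_i(0)=m_{i,k}(0)=\emptyset$ ($m_{i,p}(t)$ is the message $i$ sends through its port $p$), and $S_i(t+1)=A_{d(i)}(x_i,z_i(t),y_i(t),\mu_{i,1}(t),\ldots,\mu_{i,d(i)}(t))$, where if $j$ is the neighbor of $i$ with $\ell_i(j)=k$ then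 $\mu_{i,k}(t)=m_{j,\ell_j(i)}(t)$. An element $y^*\in Y$ is the final output of the execution if there is $t'$ with $y_i(t)=y^*$ for all nodes $i$ and all $t\ge t'$. Finite memory: $X,Y,M$ and all $Z_d$ are finite and $\log|Z_d|\le Cd$ for all $d\ge1$, for a constant $C$ independent of $d$. A family of functions $(f_n:X^n\to Y)_{n\ge1}$ is computable if there exists an automaton family with finite memory such that for every $n$, every network with $n$ nodes (every connected graph and every port labeling), and every $x\in X^n$, the execution has a final output equal to $f_n(x_1,\ldots,x_n)$. Proportions. For $X=\{1,\ldots,K\}$ and $x\in X^n$, $p_k(x)=|\{i: x_i=k\}|/n$. The proportion set is $D=\{(p_1,\ldots,p_K)\in[0,1]^K:\sum_k p_k=1\}$. A function $h:D\to Y$ is computable if the family $f_n(x)=h(p_1(x),\ldots,p_K(x))$, $x\in X^n$, is computable. *)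

(* Defs.v *)
From HB Require Import structures.
From mathcomp Require Import all_boot all_order all_algebra.
Set Implicit Arguments. Unset Strict Implicit. Unset Printing Implicit Defensive.
Import Order.TTheory GRing.Theory Num.Theory.

Definition deg (n : nat) (adj : rel 'I_n) (i : 'I_n) : nat := #|[pred j | adj i j]|.

(* The port labeling l_i is given through its inverse bijection
   port i : 'I_(deg i) -> neighbours of i (ports numbered 0..d(i)-1). *)
Record is_network (n : nat) (adj : rel 'I_n)
    (port : forall i : 'I_n, 'I_(deg adj i) -> 'I_n) : Prop := {
  net_sym : symmetric adj;
  net_irrefl : irreflexive adj;
  net_connected : forall i j : 'I_n, connect adj i j;
  net_port_inj : forall i, injective (port i);
  net_port_adj : forall i k, adj i (port i k);
  net_port_surj : forall i j, adj i j -> exists k, port i k = j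
}.

Section Exec.
Local Unset Implicit Arguments.
Variables (K : nat) (M : finType) (m0 : M) (Z : nat -> finType)
  (z0 : forall d, Z d) (Y : finType) (y0 : Y).
(* A_d : X x Z_d x Y x M^d -> X x Z_d x Y x M^d, leaving the first
   coordinate unchanged; we only record the last three output coordinates. *)
Variable A : forall d, 'I_K -> Z d -> Y -> {ffun 'I_d -> M} ->
                       (Z d * Y * {ffun 'I_d -> M})%type.
Variables (n : nat) (adj : rel 'I_n)
  (port : forall i : 'I_n, 'I_(deg adj i) -> 'I_n) (x : 'I_n -> 'I_K).

Definition node_state (i : 'I_n) := (Z (deg adj i) * Y * {ffun 'I_(deg adj i) -> M})%type.

Definition back_msg (st : forall i, node_state i) (i j : 'I_n) : M :=
  match [pick k' : 'I_(deg adj j) | port j k' == i] with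
  | Some k' => (st j).2 k'
  | None => m0
  end.

Definition incoming (st : forall i, node_state i) (i : 'I_n) : {ffun 'I_(deg adj i) -> M} :=
  [ffun k : 'I_(deg adj i) => back_msg st i (port i k)].

Fixpoint exec (t : nat) : forall i, node_state i :=
  match t with
  | 0 => fun i => (z0 (deg adj i), y0, [ffun => m0])
  | t'.+1 => fun i => let st := exec t' in
             A (deg adj i) (x i) (st i).1.1 (st i).1.2 (incoming st i)
  end.

Definition output (t : nat) (i : 'I_n) : Y := (exec t i).1.2.
End Exec.
Arguments output {K M} m0 {Z} z0 {Y} y0 A {n adj} port x t i.

(* A family f_n : X^n -> Y (n >= 1) is computable. X = 'I_K, and y0 is the
   distinguished element of Y. Finite memory: M, Z_d finite types and
   log |Z_d| <= C d for d >= 1 (equivalently |Z_d| <= 2^(C d), C natural). *)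
Definition computable (K : nat) (Y : finType) (y0 : Y)
    (f : forall n : nat, ('I_n -> 'I_K) -> Y) : Prop :=
  exists (M : finType) (m0 : M) (Z : nat -> finType) (z0 : forall d, Z d)
    (A : forall d, 'I_K -> Z d -> Y -> {ffun 'I_d -> M} ->
                   (Z d * Y * {ffun 'I_d -> M})%type),
    (exists C : nat, forall d : nat, (0 < d)%N -> (#|Z d| <= 2 ^ (C * d))%N) /\
    forall (n : nat), (0 < n)%N ->
    forall (adj : rel 'I_n) (port : forall i : 'I_n, 'I_(deg adj i) -> 'I_n),
      @is_network n adj port ->
    forall x : 'I_n -> 'I_K,
      exists t' : nat, forall t : nat, (t' <= t)%N -> forall i : 'I_n,
        output m0 z0 y0 A port x t i = f n x.

Local Open Scope ring_scope.

Definition proportion (R : realFieldType) (K n : nat) (x : 'I_n -> 'I_K) : 'I_K -> R :=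
  fun k => (#|[pred i | x i == k]|)%:R / n%:R.

Definition in_D (R : realFieldType) (K : nat) (p : 'I_K -> R) : Prop :=
  (forall k, 0 <= p k <= 1) /\ \sum_(k < K) p k = 1.

Definition computable_h (R : realFieldType) (K : nat) (Y : finType) (y0 : Y)
    (h : ('I_K -> R) -> Y) : Prop :=
  computable y0 (fun n x => h (proportion R x)).

Record lin_constr (K : nat) := LinC {
  lc_coef : 'I_K -> rat;
  lc_bound : rat;
  lc_strict : bool
}.

Definition sat (R : realFieldType) (K : nat) (c : lin_constr K) (p : 'I_K -> R) : bool :=
  let s := \sum_(k < K) ratr (lc_coef c k) * p k in
  if lc_strict c then s < ratr (lc_bound c) else s <= ratr (lc_bound c).

Definition rational_polyhedral_level_sets (R : realFieldType) (K : nat)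
    (Y : finType) (h : ('I_K -> R) -> Y) : Prop :=
  forall y : Y, exists S : seq (seq (lin_constr K)),
    forall p : 'I_K -> R, in_D p ->
      (h p = y <-> has (fun cs => all (fun c => sat c p) cs) S).

(* Main.v *)
Require Import Defs.
From Stdlib Require Import Classical_Prop.
From HB Require Import structures.
From mathcomp Require Import all_boot all_order all_algebra zify.
Set Implicit Arguments. Unset Strict Implicit. Unset Printing Implicit Defensive.
Import Order.TTheory GRing.Theory Num.Theory.

(* Every constraint amounts to comparing sum_i u(x_i) with sum_i v(x_i) for
   weights u, v : X -> nat, and computable families are closed under binary
   operations, so it suffices to decide whether sum v < sum u.

   Each node i starts with u(x_i) mobile positive units and v(x_i) static negative
   ones; the two kinds annihilate when they meet. Positive units are forwarded by
   round robin (a rotor at every node), which bounds the traffic through each port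
   by max u and guarantees that a node visited forever keeps sending to all of its
   neighbours. Hence either the positive units visit all nodes forever and no
   negative unit survives (sum u > sum v), or they die out (sum u <= sum v).

   To turn this into a stable output, a node at which a visit is entirely absorbed
   becomes a source ("idle") of mobile "low" tokens until a surviving positive unit
   passes through it. A low token reaching a node that is not "low" dies and makes
   it low; a surviving positive unit resets the node. If the positive units die out
   then some source remains and all nodes become low; otherwise the sources
   disappear, then the tokens, and then the low nodes. *)

(** * Eventual and recurrent properties of sequences *)

Definition eventually (P : nat -> Prop) := exists T, forall t, T <= t -> P t.
Definition infinitely_often (P : nat -> Prop) := forall T, exists2 t, T <= t & P t.

Lemma eventually_and P Q :
  eventually P -> eventually Q -> eventually (fun t => P t /\ Q t).
Proof.
case=> T1 h1 [T2 h2]; exists (maxn T1 T2) => t; rewrite geq_max => /andP[l1 l2].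
by split; [apply: h1 | apply: h2].
Qed.

Lemma eventually_all (I : finType) (P : I -> nat -> Prop) :
  (forall i, eventually (P i)) -> eventually (fun t => forall i, P i t).
Proof.
move=> /fin_all_exists[T hT]; exists (\max_i T i) => t le_t i.
by apply: hT; apply: leq_trans le_t; apply: leq_bigmax.
Qed.

Lemma eventually_or_infinitely_often P :
  eventually (fun t => ~ P t) \/ infinitely_often P.
Proof.
case: (classic (infinitely_often P)) => [|nio]; [by right | left].
apply: NNPP => nev; apply: nio => T; apply: NNPP => nex; apply: nev.
by exists T => t le_t Pt; apply: nex; exists t.
Qed.

(** Induction on a bound [m] for [f T]: restarting after a strict drop lowers the bound. *)
Lemma nonincreasing_eventually_stationary (f : nat -> nat) :
  eventually (fun t => f t.+1 <= f t) -> eventually (fun t => f t.+1 = f t).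
Proof.
case=> T; move: {2}(f T) (leqnn (f T)) => m.
elim: m T => [|m IHm] T le_m mono.
  have f0 t : T <= t -> f t = 0.
    move/subnK<-; elim: (t - T) => [|s IHs]; first by apply/eqP; rewrite -leqn0.
    by apply/eqP; rewrite -leqn0 -IHs addSn mono ?leq_addl.
  by exists T => t le_t; rewrite !f0 // leqW.
case: (classic (exists2 t, T <= t & f t.+1 < f t)) => [[t le_t lt_f] | nex].
  apply: (IHm t.+1) => [|s lt_s]; last by apply: mono; apply: leq_trans lt_s; rewrite leqW.
  rewrite -ltnS (leq_trans lt_f) // (leq_trans _ le_m) //.
  move: le_t => /subnK<-; elim: (t - T) => // s IHs.
  by rewrite (leq_trans _ IHs) // addSn mono ?leq_addl.
exists T => t le_t; apply/eqP; rewrite eqn_leq mono //= leqNgt.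
by apply/negP => lt_f; apply: nex; exists t.
Qed.

Lemma eventually_persistent (P : nat -> Prop) :
  eventually (fun t => P t -> P t.+1) -> infinitely_often P -> eventually P.
Proof.
case=> T step /(_ T)[t le_Tt Pt]; exists t => s /subnK<-.
elim: (s - t) => // m Pm; rewrite addSn; apply: step => //.
by rewrite (leq_trans le_Tt) ?leq_addl.
Qed.

Lemma infinitely_often_shift (P : nat -> Prop) :
  infinitely_often (fun t => P t.+1) -> infinitely_often P.
Proof. by move=> ioP T; have [t le_t Pt] := ioP T; exists t.+1; rewrite ?leqW. Qed.

Lemma infinitely_often_impl (P Q : nat -> Prop) :
  (forall t, P t -> Q t) -> infinitely_often P -> infinitely_often Q.
Proof. by move=> PQ ioP T; have [t le_t /PQ] := ioP T; exists t. Qed.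

Lemma eventually_impl (P Q : nat -> Prop) :
  (forall t, P t -> Q t) -> eventually P -> eventually Q.
Proof. by move=> PQ [T hP]; exists T => t /hP/PQ. Qed.

(** * Round-robin distribution of tokens *)

(* Round robin: of [c] tokens, the number sent through port [k] of a node of
   degree [d] whose rotor is at [r]. *)
Definition share (d c r k : nat) : nat := c %/ d + ((k + r) %% d < c %% d).

Lemma sum_rotate d (F : nat -> nat) r :
  \sum_(k < d) F ((k + r) %% d) = \sum_(k < d) F k.
Proof.
elim: r => [|r IHr]; first by apply: eq_bigr => k _; rewrite addn0 modn_small.
rewrite -IHr [RHS](reindex_inj (@ordS_inj d)).
by apply: eq_bigr => k _; rewrite /= modnDml addSnnS.
Qed.

Lemma sum_share d c r : 0 < d -> \sum_(k < d) share d c r k = c.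
Proof.
move=> d_gt0; rewrite big_split sum_nat_const card_ord /=.
rewrite (sum_rotate d (fun j => j < c %% d)) [RHS](divn_eq c d) mulnC; congr (_ + _).
rewrite -(big_mkord xpredT (fun j => nat_of_bool (j < c %% d))).
rewrite (big_cat_nat (n := c %% d)) //=; last by rewrite ltnW // ltn_pmod.
rewrite (eq_big_nat _ _ (F2 := fun=> 1)) => [|j /andP[_ ->] //].
rewrite sum_nat_const_nat subn0 muln1.
rewrite big_nat_cond big1 ?addn0 // => j /andP[/andP[le_j _] _].
by rewrite ltnNge le_j.
Qed.

Lemma share_le d c r k b : c <= b * d -> share d c r k <= b.
Proof.
rewrite /share; case: d => [|d] le_c; first by rewrite divn0 modn0; lia.
have := divn_eq c d.+1; have := ltn_pmod c (ltn0Sn d).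
case: ltnP => /=; nia.
Qed.

Lemma share_mod d c r r' e k : r = r' %[mod d] -> share d c (r + e) k = share d c (r' + e) k.
Proof.
by move=> eq_r; rewrite /share !(addnCA k) -modnDml eq_r modnDml.
Qed.

Lemma rotor_infinitely_often (c r : nat -> nat) d k :
    (forall t, r t.+1 = r t + (0 < c t.+1)) -> k < d ->
    infinitely_often (fun t => 0 < c t) ->
  infinitely_often (fun t => 0 < share d (c t) (r t) k).
Proof.
move=> rS lt_kd io_c T.
have mono s t : s <= t -> r s <= r t.
  by move/subnK<-; elim: (t - s) => // m IHm; rewrite addSn rS (leq_trans IHm) ?leq_addr.
have unbounded m : exists t, m <= r t.
  elim: m => [|m [t le_m]]; first by exists 0.
  have [[//|t'] lt_t c_gt0] := io_c t.+1.
  by exists t'.+1; rewrite rS c_gt0 addn1 ltnS (leq_trans le_m) ?mono.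
(* At rotor value [m], congruent to [- k] modulo [d], port [k] is served first; [m] also exceeds
   [r T]. *)
pose m := (r T).+1 * d + (d - k).
have exm : exists t, m <= r t by apply: unbounded.
(* The rotor moves by at most one, and only at visits, so it first reaches [m] during a visit and
   with exactly that value. *)
case: (ex_minnP exm) => t le_m min_t.
have lt_rT : r T < m by rewrite /m; nia.
have lt_Tt : T < t by rewrite ltnNge; apply/negP => /mono; lia.
case: t lt_Tt le_m min_t => // t le_Tt le_m min_t.
have lt_rt : r t < m by rewrite ltnNge; apply/negP => /min_t; rewrite ltnn.
exists t.+1; first exact: ltnW.
have c_gt0 : 0 < c t.+1 by move: le_m; rewrite rS; case: (0 < _) => //; lia.
have -> : r t.+1 = m by move: le_m; rewrite rS c_gt0; lia.
rewrite /share (_ : k + m = (r T).+2 * d); last by rewrite /m; nia.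
rewrite modnMl; have := divn_eq (c t.+1) d; case: (_ %/ _) => [|?] //.
by rewrite mul0n !add0n => <-; rewrite c_gt0.
Qed.

(** * Token dynamics on a network *)

(* [load]: mobile positive units about to leave; [debt]: static negative units;
   [idle]: no unit has gone through since a visit was last fully absorbed;
   [low]: current guess that the sum is <= 0; [tok]: a mobile low token is about
   to leave; [rotor], [trotor]: the rotors of the two kinds of tokens. *)
Record node := Node {
  load : nat; debt : nat; idle : bool; low : bool; rotor : nat; tok : bool; trotor : nat
}.

(** [a] units and [b] low tokens arrive. Simultaneous tokens merge into one, and [tok'] reads the
    old [low], so a token reaching a node that is not low stops there. *)
Definition step (a b : nat) (s : node) : node :=
  let load' := a - debt s in
  let idle' := if 0 < a then load' == 0 else idle s in
  let hit := idle' || (0 < b) in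
  let tok' := [&& load' == 0, low s & hit] in
  Node load' (debt s - a) idle' ((load' == 0) && (low s || hit))
    (rotor s + (0 < load')) tok' (trotor s + tok').

Section Network.
Variables (n : nat) (adj : rel 'I_n) (port : forall i : 'I_n, 'I_(deg adj i) -> 'I_n).
Hypothesis net : is_network port.

Definition back (j i : 'I_n) : nat :=
  if [pick k | port k == i :> 'I_n] is Some k then val (k : 'I_(deg adj j)) else 0.

Lemma back_port j k : back j (@port j k) = k.
Proof.
rewrite /back; case: pickP => [k' /eqP/(net_port_inj net)-> // | /(_ k)].
by rewrite eqxx.
Qed.

Lemma sum_port i (F : 'I_n -> nat) :
  \sum_(k < deg adj i) F (port k) = \sum_(j | adj i j) F j.
Proof.
rewrite (partition_big (@port i) (adj i)) => [|k _]; last exact: (net_port_adj net).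
apply: eq_bigr => j /(net_port_surj net)[k0 <-].
rewrite (big_pred1 k0) // => k; apply/eqP/eqP => [/(net_port_inj net) | ->] //.
Qed.

Lemma connected_spread (P : 'I_n -> Prop) i :
  (forall j l, adj j l -> P j -> P l) -> P i -> forall j, P j.
Proof.
move=> spread Pi j; have /connectP[p] := net_connected net i j.
elim: p i Pi => [i Pi _ -> //|l p IHp i Pi] /= /andP[il pp] def_j.
exact: (IHp l (spread _ _ il Pi) pp def_j).
Qed.

Definition recv (c r : 'I_n -> nat) (i : 'I_n) : nat :=
  \sum_(j | adj i j) share (deg adj j) (c j) (r j) (back j i).

Lemma recv_infinitely_often (c r : nat -> 'I_n -> nat) i j :
    adj i j -> (forall t, r t.+1 i = r t i + (0 < c t.+1 i)) ->
    infinitely_often (fun t => 0 < c t i) ->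
  infinitely_often (fun t => 0 < recv (c t) (r t) j).
Proof.
move=> /[dup] ij /(net_port_surj net)[k def_j] rS io_c.
have := rotor_infinitely_often rS (ltn_ord k) io_c.
apply: infinitely_often_impl => t gt0.
have ji : adj j i by rewrite (net_sym net).
by rewrite /recv (bigD1 i ji) /= -def_j back_port addn_gt0 gt0.
Qed.

Hypothesis deg_gt0 : forall i, 0 < deg adj i.

(** After exchanging the sums, the shares leaving each node add up to what it held, as every node
    has a port. *)
Lemma sum_recv (c r : 'I_n -> nat) : \sum_i recv c r i = \sum_i c i.
Proof.
rewrite /recv (exchange_big_dep xpredT) //=; apply: eq_bigr => j _.
rewrite (eq_bigl (adj j)) => [|i]; last by rewrite (net_sym net).
rewrite -sum_port -[RHS](sum_share _ (r j) (deg_gt0 j)).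
by apply: eq_bigr => k _; rewrite back_port.
Qed.

Variables (u v : 'I_n -> nat) (low0 : bool).

(** The initial units count as a first arrival, so [u] and [v] cancel locally and a node left
    without load starts as a source. [low0] is arbitrary because the default output is imposed. *)
Fixpoint run (t : nat) (i : 'I_n) : node :=
  if t is t'.+1 then
    step (recv (load \o run t') (rotor \o run t') i) (recv (tok \o run t') (trotor \o run t') i)
      (run t' i)
  else step (u i) 0 (Node 0 (v i) true low0 0 false 0).

Let loads_in t i := recv (load \o run t) (rotor \o run t) i.
Let toks_in t i := recv (tok \o run t) (trotor \o run t) i.

Lemma runS t i : run t.+1 i = step (loads_in t i) (toks_in t i) (run t i).
Proof. by []. Qed.

Lemma conservation t :
  \sum_i load (run t i) + \sum_i v i = \sum_i u i + \sum_i debt (run t i).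
Proof.
elim: t => [|t IHt].
  by rewrite -!big_split; apply: eq_bigr => i _ /=; lia.
have : \sum_i load (run t.+1 i) + \sum_i debt (run t i)
     = \sum_i loads_in t i + \sum_i debt (run t.+1 i).
  by rewrite -!big_split; apply: eq_bigr => i _; rewrite runS /=; lia.
rewrite sum_recv /=; move: IHt => /=; lia.
Qed.

(** Either some visit was absorbed in the last step, which makes its node idle, or the loads were
    already zero before it and an earlier idle node has stayed so. *)
Lemma no_load_idle t : 0 < n ->
  (forall i, load (run t i) = 0) -> exists i, idle (run t i).
Proof.
move=> n_gt0; elim: t => [|t IHt] no_load.
  exists (Ordinal n_gt0); move: (no_load (Ordinal n_gt0)) => /= ->.
  by rewrite eqxx if_same.
case: (boolP [exists i, 0 < loads_in t i]) => [/existsP[i gt0] | /existsPn no_loads_in].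
  by exists i; move: (no_load i); rewrite runS /= gt0 => ->.
have sum0 : \sum_i load (run t i) = 0.
  rewrite -(sum_recv _ (rotor \o run t)) big1 // => i _.
  by apply/eqP; rewrite -leqn0 leqNgt no_loads_in.
have [i] : exists i, idle (run t i).
  by apply: IHt => i; apply/eqP; move/eqP: sum0; rewrite sum_nat_eq0 => /forallP/(_ i).
by exists i; rewrite runS /= (negbTE (no_loads_in i)).
Qed.

Lemma loaded t i :
  0 < load (run t i) -> [/\ debt (run t i) = 0, idle (run t i) = false & low (run t i) = false].
Proof.
have loaded_step a b s : 0 < load (step a b s) ->
    [/\ debt (step a b s) = 0, idle (step a b s) = false & low (step a b s) = false].
  move=> /= gt0; have -> /= : (a - debt s == 0) = false by lia.
  have -> : 0 < a by lia.
  by split=> //; lia.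
by case: t => [|t]; apply: loaded_step.
Qed.

(* Once the debt is stationary, every arriving unit is forwarded. *)
Lemma load_infinitely_often i :
  infinitely_often (fun t => 0 < loads_in t i) -> infinitely_often (fun t => 0 < load (run t i)).
Proof.
move=> io_i.
have [T stat] : eventually (fun t => debt (run t.+1 i) = debt (run t i)).
  by apply: nonincreasing_eventually_stationary; exists 0 => t _; rewrite runS leq_subr.
apply: infinitely_often_shift => T'.
have [t] := io_i (maxn T T'); rewrite geq_max => /andP[le_t le_t'] gt0.
by exists t => //; move: (stat t le_t); rewrite runS /=; lia.
Qed.

Lemma loads_in_spread i j :
  infinitely_often (fun t => 0 < loads_in t i) -> infinitely_often (fun t => 0 < loads_in t j).
Proof.
move=> ioi; apply: (connected_spread (P := fun i => infinitely_often (fun t => 0 < loads_in t i))) ioi j.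
move=> {i} i j ij io_i.
exact: recv_infinitely_often ij (fun=> erefl) (load_infinitely_often io_i).
Qed.

(* The positive units sweep every node forever: they pay off all debts and clear
   all [idle] sources, after which low tokens only disappear, so that a node
   cleared of [low] after the number of tokens has stabilised stays clear. *)
Lemma low_of_persistent_load i0 : infinitely_often (fun t => 0 < loads_in t i0) ->
  eventually (fun t => forall i, low (run t i) = false) /\ \sum_i v i < \sum_i u i.
Proof.
move=> io0; have io_load i : infinitely_often (fun t => 0 < load (run t i)).
  exact/load_infinitely_often/(loads_in_spread i io0).
have debt0 : eventually (fun t => forall i, debt (run t i) = 0).
  apply: eventually_all => i; apply: eventually_persistent.
    by exists 0 => t _; rewrite runS /= => ->.
  by apply: infinitely_often_impl (io_load i) => t /loaded[].
have idle0 : eventually (fun t => forall i, idle (run t i) = false).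
  apply: eventually_all => i; apply: eventually_persistent.
    apply: eventually_impl debt0 => t /(_ i) d0 id0.
    by rewrite runS /= id0 d0 subn0; case: ltngtP.
  by apply: infinitely_often_impl (io_load i) => t /loaded[].
split; last first.
  have [T hT] := debt0; have [t /hT d0 gt0] := io_load i0 T.
  have := conservation t; rewrite [X in _ = _ + X]big1 // addn0 => <-.
  by rewrite -[X in X < _]add0n ltn_add2r (bigD1 i0) //= addn_gt0 gt0.
have tok_le : eventually (fun t => forall i, tok (run t.+1 i) <= toks_in t i).
  case: idle0 => T id0; exists T => t le_t i.
  have := id0 t.+1 (leqW le_t) i; rewrite runS /= => ->.
  case: (posnP (toks_in t i)) => [->|gt0]; first by rewrite !andbF.
  exact: leq_trans (leq_b1 _) gt0.
have tok_stat : eventually (fun t => forall i, nat_of_bool (tok (run t.+1 i)) = toks_in t i).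
  have [T le_tok] := tok_le.
  have [T' eq_tok] : eventually (fun t =>
      \sum_i tok (run t.+1 i) = \sum_i nat_of_bool (tok (run t i))).
    apply: nonincreasing_eventually_stationary; exists T => t le_t.
    rewrite -(sum_recv (fun i => tok (run t i)) (trotor \o run t)).
    by apply: leq_sum => i _; apply: le_tok.
  exists (maxn T T') => t; rewrite geq_max => /andP[le_t le_t'] i.
  have := leqif_sum (P := xpredT) (fun i _ => leqif_eq (le_tok t le_t i)).
  case=> _; rewrite eq_tok // -(sum_recv (fun i => tok (run t i)) (trotor \o run t)) eqxx.
  by move=> /esym/forallP/(_ i)/eqP.
apply: eventually_all => i; apply: eventually_persistent.
  (* A clear node would absorb any token it received; since none is lost any more, none arrives and
     the node stays clear. *)
  have [T] := eventually_and idle0 tok_stat.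
  move=> hT; exists T => t le_t low_f; have [_ /(_ i)] := hT t le_t.
  have [/(_ i) id0 _] := hT t.+1 (leqW le_t).
  move: id0; rewrite runS /= => ->; rewrite low_f andbF /= => <-.
  by rewrite andbF.
by apply: infinitely_often_impl (io_load i) => t /loaded[].
Qed.

(* The last visit left an [idle] node behind; it feeds low tokens forever, and
   these flood the network since no load erases them any more. *)
Lemma low_of_vanishing_load : 0 < n -> eventually (fun t => forall i, loads_in t i = 0) ->
  eventually (fun t => forall i, low (run t i) = true) /\ \sum_i u i <= \sum_i v i.
Proof.
move=> n_gt0 [T loads_in0].
have load0 t i : T < t -> load (run t i) = 0.
  by case: t => // t; rewrite ltnS runS => le_t /=; rewrite loads_in0.
split; last first.
  have := conservation T.+1; rewrite [X in X + _]big1 => [|i _]; last exact: load0.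
  by rewrite add0n => ->; rewrite leq_addr.
have [i0 idle_i0] : exists i, idle (run T.+1 i).
  by apply: no_load_idle => // i; apply: load0.
have idleT t : T < t -> idle (run t i0).
  move/subnK<-; elim: (t - _) => // m IHm; rewrite addSn runS /= loads_in0 //; lia.
have lowS i : eventually (fun t => low (run t i) -> low (run t.+1 i)).
  by exists T => t le_t; rewrite runS /= loads_in0 // => ->.
have io_low i : infinitely_often (fun t => tok (run t i)) -> eventually (fun t => low (run t i)).
  move=> io_tok; apply: eventually_persistent => //.
  apply: infinitely_often_shift => T'; have [[//|t] lt_t] := io_tok T'.+1.
  by rewrite runS /= => /and3P[ld lw _]; exists t => //; rewrite /= ld lw.
have io_tok i : infinitely_often (fun t => tok (run t i)).
  (* Emission spreads along edges: after time [T], the first token to reach [j] makes it low for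
     good, and every later arrival triggers an emission. *)
  apply: (connected_spread (i := i0) (P := fun i => infinitely_often (fun t => tok (run t i)))).
    move=> {}i j ij io_i.
    have io_toks_in : infinitely_often (fun t => 0 < toks_in t j).
      apply: (@recv_infinitely_often (fun t l => tok (run t l)) (fun t l => trotor (run t l)) i j) => // [t|].
        by rewrite lt0b.
      by apply: infinitely_often_impl io_i => t ->.
    have low_j : eventually (fun t => low (run t j)).
      apply: eventually_persistent => //; apply: infinitely_often_shift => T'.
      have [t] := io_toks_in (maxn T T'); rewrite geq_max => /andP[le_t le_t'] gt0.
      by exists t => //; rewrite runS /= loads_in0 // gt0 !orbT.
    have [T1 low_T1] := low_j; apply: infinitely_often_shift => T'.
    have [t] := io_toks_in (maxn (maxn T T1) T'); rewrite !geq_max => /andP[/andP[l1 l2] l3] gt0.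
    by exists t => //; rewrite runS /= loads_in0 // gt0 orbT low_T1.
  have tokS t : T <= t -> tok (run t.+1 i0) = low (run t i0) && (idle (run t i0) || (0 < toks_in t i0)).
    by move=> le_t; rewrite runS /= loads_in0.
  have low_i0 t : T < t -> low (run t.+1 i0).
    by move=> lt_t; rewrite runS /= loads_in0 ?idleT ?orbT // ltnW.
  (* From [T.+1] on [i0] is idle, one step later it is low, and one step after that it emits. *)
  move=> T'; exists (maxn T T').+3; first by lia.
  by rewrite tokS ?idleT ?low_i0 //; lia.
by apply: eventually_all => i; apply: eventually_impl (io_low i (io_tok i)).
Qed.

Theorem run_low : 0 < n ->
  eventually (fun t => forall i, low (run t i) = ~~ (\sum_i v i < \sum_i u i)).
Proof.
move=> n_gt0; case: (classic (exists i, infinitely_often (fun t => 0 < loads_in t i))).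
  by case=> i /low_of_persistent_load[ev ->].
move=> no_io; have [|ev le_uv] := low_of_vanishing_load n_gt0; last by rewrite ltnNge le_uv.
apply: eventually_all => i.
have [ev|io] := eventually_or_infinitely_often (fun t => 0 < loads_in t i).
  by apply: eventually_impl ev => t; lia.
by case: no_io; exists i.
Qed.
End Network.

(** * Realization by an automaton with finite memory *)

Section Automaton.
Variables (B K : nat) (u v : 'I_K -> nat).
Hypotheses (B_gt0 : 0 < B) (u_le : forall k, u k <= B) (v_le : forall k, v k <= B).

Definition message : finType := ('I_B.+1 * 'I_B.+1)%type.
(** [None] marks the first step, when [u] and [v] are still to be loaded. [load] and [tok] live only
    in the messages, [low] is the negated output, and the rotors are kept modulo [d]. *)
Definition memory (d : nat) : finType := option ('I_B.+1 * bool * 'I_d.+1 * 'I_d.+1).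

Definition decode (d : nat) (k : 'I_K) (m : memory d) (y : bool) : node :=
  if m is Some (b, z, r, r') then Node 0 b z (~~ y) r false r'
  else Node 0 (v k) true (~~ y) 0 false 0.

Definition encode (d : nat) (s : node) : memory d * bool * {ffun 'I_d -> message} :=
  (Some (inord (debt s), idle s, inord (rotor s %% d), inord (trotor s %% d)), ~~ low s,
   [ffun k : 'I_d => (inord (share d (load s) (rotor s) k), inord (share d (tok s) (trotor s) k))]).

(* A node of degree 0 is the whole network and answers at once: its loads would
   have no port to leave by. *)
Definition automaton (d : nat) (k : 'I_K) (m : memory d) (y : bool)
    (mu : {ffun 'I_d -> message}) : memory d * bool * {ffun 'I_d -> message} :=
  let a := \sum_p (mu p).1 + (if m is None then u k else 0) in
  let e := encode d (step a (\sum_p (mu p).2) (decode k m y)) in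
  if d == 0 then (e.1.1, v k < u k, e.2) else e.

Lemma card_memory d : 0 < d -> #|memory d| <= 2 ^ ((B + 4) * d).
Proof.
move=> d_gt0; rewrite card_option !card_prod card_bool !card_ord.
have lt_B := ltn_expl B (isT : 1 < 2); have lt_d := ltn_expl d (isT : 1 < 2).
apply: (@leq_trans (2 ^ (B + 2 + d + d))); last by rewrite leq_exp2l //; nia.
rewrite !expnD -(mulnA (2 ^ B)); set X := 2 ^ B in lt_B *; set D := 2 ^ d in lt_d *.
have : B.+1 * 2 * d.+1 * d.+1 <= X * 2 * D * D by rewrite !leq_mul.
have : 0 < X * D * D by rewrite !muln_gt0 (leq_ltn_trans _ lt_d) // (leq_ltn_trans _ lt_B).
lia.
Qed.

Lemma automaton_isolated d k m y mu : d = 0 -> (@automaton d k m y mu).1.2 = (v k < u k).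
Proof. by move=> d0; move: m mu; rewrite d0. Qed.

(** Decoding loses only [load], [tok] and multiples of [d] in the rotors: [step] never reads the
    first two, and [share] sees rotors only modulo [d]. *)
Lemma encode_step_decode d k a b s : 0 < d -> debt s <= B ->
  encode d (step a b (decode k (encode d s).1.1 (encode d s).1.2)) = encode d (step a b s).
Proof.
move=> d_gt0 debt_le; have lt_mod r : r %% d < d.+1 by rewrite ltnS ltnW // ltn_pmod.
rewrite /encode /decode /= !inordK // !modnDml negbK; congr (_, _).
by apply/ffunP => p; rewrite !ffunE !(share_mod _ _ _ (modn_mod _ _)).
Qed.

Variables (n : nat) (adj : rel 'I_n) (port : forall i : 'I_n, 'I_(deg adj i) -> 'I_n).
Variables (x : 'I_n -> 'I_K) (y0 : bool).
Hypotheses (net : is_network port) (deg_gt0 : forall i, 0 < deg adj i).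

Let st := run port (u \o x) (v \o x) (~~ y0).

Lemma debt_le t i : debt (st t i) <= B.
Proof.
elim: t => [|t IHt]; first by rewrite /= (leq_trans (leq_subr _ _)).
by rewrite /st runS (leq_trans (leq_subr _ _)).
Qed.

Lemma tok_le (b : bool) i : b <= B * deg adj i.
Proof. by rewrite (leq_trans (leq_b1 _)) // muln_gt0 B_gt0 deg_gt0. Qed.

(** With at most [B] units per port on every node, round robin sends at most [B] through each port,
    so the bound persists and the shares fit in ['I_B.+1]. *)
Lemma load_le t i : load (st t i) <= B * deg adj i.
Proof.
elim: t i => [|t IHt] i.
  by rewrite /= (leq_trans (leq_subr _ _)) // (leq_trans (u_le _)) // leq_pmulr.
rewrite /st runS (leq_trans (leq_subr _ _)) // /recv -(sum_port net).
rewrite mulnC -[X in X * _]card_ord -sum_nat_const leq_sum // => p _.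
by apply: share_le; apply: IHt.
Qed.

Let ex := exec K message (ord0, ord0) memory (fun=> None) bool y0 automaton n adj port x.

Lemma execS t i : ex t.+1 i = automaton (x i) (ex t i).1.1 (ex t i).1.2
  (incoming message (ord0, ord0) memory bool n adj port (ex t) i).
Proof. by []. Qed.

Lemma incoming_encode t i p : (forall j, ex t.+1 j = encode (deg adj j) (st t j)) ->
  incoming message (ord0, ord0) memory bool n adj port (ex t.+1) i p =
  let j := port p in
  (inord (share (deg adj j) (load (st t j)) (rotor (st t j)) (back port j i)),
   inord (share (deg adj j) (tok (st t j)) (trotor (st t j)) (back port j i))).
Proof.
move=> ex_enc; rewrite ffunE /back_msg ex_enc; set j := port p.
have [q def_i] : exists q : 'I_(deg adj j), port q = i.
  by apply: (net_port_surj net); rewrite (net_sym net); apply: (net_port_adj net).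
case: pickP => [q' /eqP def_q' | /(_ q)]; last by rewrite def_i eqxx.
rewrite !ffunE; have -> : back port j i = q' by rewrite -def_q' (back_port net).
by [].
Qed.

(** The execution lags by one step: it starts blank, and its first transition brings in the initial
    units. *)
Lemma exec_run t i : ex t.+1 i = encode (deg adj i) (st t i).
Proof.
have deg_neq0 j : (deg adj j == 0) = false by rewrite -leqn0 leqNgt deg_gt0.
elim: t i => [|t IHt] i.
  rewrite execS /automaton deg_neq0 /= !big1 ?add0n // => p _;
  by rewrite /incoming !ffunE /back_msg; case: pickP => [q _|//]; rewrite ffunE.
rewrite execS /automaton deg_neq0 IHt addn0.
rewrite encode_step_decode ?debt_le // /st runS; congr (encode _ (step _ _ _)).
  rewrite /recv -(sum_port net); apply: eq_bigr => p _.
  by rewrite incoming_encode // inordK // ltnS share_le // load_le.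
rewrite /recv -(sum_port net); apply: eq_bigr => p _.
by rewrite incoming_encode // inordK // ltnS share_le // tok_le.
Qed.
End Automaton.

(** * Computability of integer thresholds *)

Lemma deg_gt0 n (adj : rel 'I_n) (port : forall i : 'I_n, 'I_(deg adj i) -> 'I_n) i :
  is_network port -> 1 < n -> 0 < deg adj i.
Proof.
move=> net n_gt1; have [j neq_ij] : exists j : 'I_n, j != i.
  exists (if val i == 0 then Ordinal n_gt1 else Ordinal (ltnW n_gt1)).
  by rewrite -val_eqE; case: i => [[|i] lt_i].
have /connectP[[|l p] /= pth def_j] := net_connected net i j.
  by rewrite def_j eqxx in neq_ij.
by apply/card_gt0P; exists l; rewrite inE; case/andP: pth.
Qed.

Theorem computable_threshold K (u v : 'I_K -> nat) (y0 : bool) :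
  computable y0 (fun n (x : 'I_n -> 'I_K) => \sum_i v (x i) < \sum_i u (x i)).
Proof.
(* The successor makes [B] positive, so that a low token also fits in a message. *)
pose B := (\max_k u k + \max_k v k).+1.
have u_le k : u k <= B by rewrite /B leqW // (leq_trans (leq_bigmax k)) // leq_addr.
have v_le k : v k <= B by rewrite /B leqW // (leq_trans (leq_bigmax k)) // leq_addl.
exists (message B), (ord0, ord0), (memory B), (fun=> None), (automaton u v).
split; first by exists (B + 4) => d; apply: card_memory.
move=> [|[|n]] // n_gt0 adj port net x.
  exists 1 => -[|t] // _ i.
  have deg0 : deg adj i = 0.
    by apply: eq_card0 => j; rewrite inE (ord1 i) (ord1 j) (net_irrefl net).
  by rewrite !big_ord1 /output /= automaton_isolated // (ord1 i).
have dg i := deg_gt0 i net (isT : 1 < n.+2).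
have [T low_T] := run_low net dg (u \o x) (v \o x) (~~ y0) n_gt0.
exists T.+1 => -[|t] // le_t i.
by rewrite /output (exec_run _ u_le v_le) // /= low_T // negbK.
Qed.

(** * Closure properties of computable families *)

Lemma computable_ext K (Y : finType) (y0 : Y) (f g : forall n, ('I_n -> 'I_K) -> Y) :
  (forall n (x : 'I_n -> 'I_K), 0 < n -> f n x = g n x) -> computable y0 f -> computable y0 g.
Proof.
move=> fg [M [m0 [Z [z0 [A [Zle fA]]]]]]; exists M, m0, Z, z0, A; split=> // n n_gt0 adj port net x.
by have [T hT] := fA n n_gt0 adj port net x; exists T => t le_t i; rewrite -fg // hT.
Qed.

Lemma computable_const K (Y : finType) (y0 y : Y) :
  computable y0 (fun n (_ : 'I_n -> 'I_K) => y).
Proof.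
exists unit, tt, (fun=> unit), (fun=> tt), (fun d _ _ _ _ => (tt, y, [ffun=> tt])).
split; first by exists 0 => d _; rewrite card_unit.
by move=> n _ adj port _ x; exists 1 => -[].
Qed.

Section Product.
Variables (K : nat) (M1 M2 : finType) (m1 : M1) (m2 : M2) (Z1 Z2 : nat -> finType).
Variables (z1 : forall d, Z1 d) (z2 : forall d, Z2 d) (Y1 Y2 Y : finType).
Variables (y1 : Y1) (y2 : Y2) (y0 : Y) (g : Y1 -> Y2 -> Y).
Variable A1 : forall d, 'I_K -> Z1 d -> Y1 -> {ffun 'I_d -> M1} ->
  (Z1 d * Y1 * {ffun 'I_d -> M1})%type.
Variable A2 : forall d, 'I_K -> Z2 d -> Y2 -> {ffun 'I_d -> M2} ->
  (Z2 d * Y2 * {ffun 'I_d -> M2})%type.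

(** The outputs of the factors are kept in memory, since the common output shows only their
    combination by [g]. *)
Definition prod_memory (d : nat) : finType := ((Z1 d * Y1) * (Z2 d * Y2))%type.

Definition prod_automaton d (k : 'I_K) (z : prod_memory d) (_ : Y)
    (mu : {ffun 'I_d -> M1 * M2}) : prod_memory d * Y * {ffun 'I_d -> M1 * M2} :=
  let e1 := A1 k z.1.1 z.1.2 [ffun p => (mu p).1] in
  let e2 := A2 k z.2.1 z.2.2 [ffun p => (mu p).2] in
  ((e1.1, e2.1), g e1.1.2 e2.1.2, [ffun p => (e1.2 p, e2.2 p)]).

Lemma card_prod_memory C1 C2 d : 0 < d ->
  #|Z1 d| <= 2 ^ (C1 * d) -> #|Z2 d| <= 2 ^ (C2 * d) ->
  #|prod_memory d| <= 2 ^ ((C1 + #|Y1| + (C2 + #|Y2|)) * d).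
Proof.
move=> d_gt0 le1 le2; rewrite !card_prod !mulnDl !expnD !leq_mul //.
all: by apply: leq_trans (ltnW (ltn_expl _ (isT : 1 < 2))) _; rewrite leq_exp2l // leq_pmulr.
Qed.

Variables (n : nat) (adj : rel 'I_n) (port : forall i : 'I_n, 'I_(deg adj i) -> 'I_n).
Variable x : 'I_n -> 'I_K.

Let ex1 := exec K M1 m1 Z1 z1 Y1 y1 A1 n adj port x.
Let ex2 := exec K M2 m2 Z2 z2 Y2 y2 A2 n adj port x.
Let ex := exec K (M1 * M2)%type (m1, m2) prod_memory (fun d => ((z1 d, y1), (z2 d, y2))) Y y0
  prod_automaton n adj port x.

Lemma exec_prod t i :
  (ex t i).1.1 = ((ex1 t i).1, (ex2 t i).1) /\
  (ex t i).2 = [ffun p => ((ex1 t i).2 p, (ex2 t i).2 p)].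
Proof.
elim: t i => [|t IHt] i; first by split=> //; apply/ffunP => p; rewrite !ffunE.
have inc p : incoming (M1 * M2)%type (m1, m2) prod_memory Y n adj port (ex t) i p =
    (incoming M1 m1 Z1 Y1 n adj port (ex1 t) i p, incoming M2 m2 Z2 Y2 n adj port (ex2 t) i p).
  rewrite !ffunE /back_msg; case: pickP => // q _.
  by rewrite (IHt _).2 ffunE.
have [IH1 _] := IHt i; rewrite /ex /= -/(ex t) /prod_automaton IH1 /=.
have -> : [ffun p => (incoming (M1 * M2)%type (m1, m2) prod_memory Y n adj port (ex t) i p).1]
    = incoming M1 m1 Z1 Y1 n adj port (ex1 t) i.
  by apply/ffunP => p; rewrite ffunE inc.
have -> : [ffun p => (incoming (M1 * M2)%type (m1, m2) prod_memory Y n adj port (ex t) i p).2]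
    = incoming M2 m2 Z2 Y2 n adj port (ex2 t) i.
  by apply/ffunP => p; rewrite ffunE inc.
by [].
Qed.

(** Stated from the first step on: at time 0 the output is [y0], unrelated to [g y1 y2]. *)
Lemma output_prod t i :
  output (m1, m2) (fun d => ((z1 d, y1), (z2 d, y2))) y0 prod_automaton port x t.+1 i =
  g (output m1 z1 y1 A1 port x t.+1 i) (output m2 z2 y2 A2 port x t.+1 i).
Proof. by have [] := exec_prod t.+1 i; rewrite /output /= => -[-> ->]. Qed.
End Product.

Lemma computable_binop K (Y1 Y2 Y : finType) (y1 : Y1) (y2 : Y2) (y0 : Y) (g : Y1 -> Y2 -> Y)
    (f1 : forall n, ('I_n -> 'I_K) -> Y1) (f2 : forall n, ('I_n -> 'I_K) -> Y2) :
  computable y1 f1 -> computable y2 f2 -> computable y0 (fun n x => g (f1 n x) (f2 n x)).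
Proof.
move=> [M1 [m1 [Z1 [z1 [A1 [[C1 le1] h1]]]]]] [M2 [m2 [Z2 [z2 [A2 [[C2 le2] h2]]]]]].
exists (M1 * M2)%type, (m1, m2), (prod_memory Z1 Z2 Y1 Y2), (fun d => ((z1 d, y1), (z2 d, y2))).
exists (prod_automaton g A1 A2); split.
  by eexists => d d_gt0; apply: card_prod_memory (le1 d d_gt0) (le2 d d_gt0).
move=> n n_gt0 adj port net x.
have [T1 hT1] := h1 n n_gt0 adj port net x; have [T2 hT2] := h2 n n_gt0 adj port net x.
exists (maxn T1 T2).+1 => -[|t] // le_t i.
by rewrite output_prod hT1 ?hT2 //; lia.
Qed.

(** * Reduction of rational constraints to integer weights *)

Local Open Scope ring_scope.

Lemma common_denominator K (q : 'I_K -> rat) : exists D : nat, (0 < D)%N /\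
  exists u v : 'I_K -> nat, forall k, D%:R * q k = (u k)%:R - (v k)%:R.
Proof.
exists (\prod_k `|denq (q k)|)%N; split.
  by rewrite prodn_gt0 // => k; rewrite absz_gt0 denq_neq0.
suff /fin_all_exists[uv uvE] : forall k, exists uv : nat * nat,
    (\prod_k `|denq (q k)|)%N%:R * q k = uv.1%:R - uv.2%:R.
  by exists (fst \o uv), (snd \o uv).
move=> k; rewrite (bigD1 k) //=; set m := (\prod_(_ | _) _)%N.
have -> : (`|denq (q k)| * m)%N%:R * q k = (numq (q k) * m%:Z)%:~R.
  rewrite natrM mulrAC [`|_|%:R]pmulrn absz_denq intrM.
  by rewrite -{2}(divq_num_den (q k)) mulrCA mulfV ?mulr1 // intr_eq0 denq_neq0.
case: (_ * _) => j; [exists (j, 0%N) | exists (0%N, j.+1)]; rewrite /= ?subr0 //.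
by rewrite NegzE mulrNz sub0r.
Qed.

Section Proportions.
Variables (R : realFieldType) (K n : nat) (x : 'I_n -> 'I_K).
Hypothesis n_gt0 : (0 < n)%N.

Lemma sum_proportion (F : 'I_K -> R) :
  \sum_k F k * proportion R x k = (\sum_i F (x i)) / n%:R.
Proof.
rewrite (partition_big x xpredT) //= mulr_suml; apply: eq_bigr => k _.
rewrite mulrA; congr (_ / _).
rewrite (eq_bigr (fun=> F k)) => [|i /eqP-> //].
by rewrite sumr_const mulr_natr.
Qed.

Lemma proportion_in_D : in_D (proportion R x).
Proof.
have n_pos : 0 < n%:R :> R by rewrite ltr0n.
split=> [k|].
  rewrite /proportion divr_ge0 ?ler0n //= ler_pdivrMr // mul1r ler_nat.
  by rewrite -[X in (_ <= X)%N]card_ord max_card.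
under eq_bigr do rewrite -[proportion _ _ _]mul1r.
by rewrite sum_proportion sumr_const card_ord mulfV // gt_eqF.
Qed.
End Proportions.

(** The bound is absorbed into the coefficients as [b - a k]; clearing denominators and multiplying
    by [n] gives integer sums over the nodes. The weights are chosen before [n], as the automaton
    may not depend on the network size. *)
Lemma compare_proportions (R : realFieldType) K (a : 'I_K -> rat) (b : rat) :
  exists u v : 'I_K -> nat, forall n (x : 'I_n -> 'I_K), (0 < n)%N ->
    let s := \sum_k ratr (a k) * proportion R x k in
    (s < ratr b) = (\sum_i v (x i) < \sum_i u (x i))%N /\
    (ratr b < s) = (\sum_i u (x i) < \sum_i v (x i))%N.
Proof.
have [D [D_gt0 [u [v uvE]]]] := common_denominator (fun k => b - a k).
exists u, v => n x n_gt0 s.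
have n_pos : 0 < n%:R :> R by rewrite ltr0n.
have D_pos : 0 < D%:R :> R by rewrite ltr0n.
have sE : D%:R * n%:R * (ratr b - s)
    = (\sum_i u (x i))%N%:R - (\sum_i v (x i))%N%:R :> R.
  rewrite /s sum_proportion -mulrA mulrBr [X in _ * (_ - X)]mulrCA mulfV ?gt_eqF // mulr1.
  have -> : n%:R * ratr b = \sum_(i < n) ratr b :> R by rewrite sumr_const card_ord mulr_natl.
  rewrite -sumrB mulr_sumr !natr_sum -sumrB; apply: eq_bigr => i _.
  rewrite -rmorphB /= -[D%:R](ratr_nat R) -rmorphM /= uvE.
  by rewrite rmorphB /= !ratr_nat.
have Dn_pos : 0 < D%:R * n%:R :> R by rewrite mulr_gt0.
split.
  by rewrite -subr_gt0 -(pmulr_rgt0 _ Dn_pos) sE subr_gt0 ltr_nat.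
by rewrite -subr_lt0 -(pmulr_rlt0 _ Dn_pos) sE subr_lt0 ltr_nat.
Qed.

Lemma computable_sat (R : realFieldType) K (c : lin_constr K) :
  computable false (fun n (x : 'I_n -> 'I_K) => sat c (proportion R x)).
Proof.
case: c => a b strict; have [u [v uvE]] := compare_proportions R a b.
case: strict.
  apply: computable_ext (computable_threshold u v false) => n x n_gt0.
  by rewrite /sat /= (uvE n x n_gt0).1.
(* The non-strict constraint is the negation of the reversed strict one, with negation passed as a
   binary operation. *)
apply: computable_ext (computable_binop false (fun b1 _ : bool => ~~ b1)
  (computable_threshold v u false) (computable_threshold v u false)) => n x n_gt0.
by rewrite /sat /= leNgt (uvE n x n_gt0).2.
Qed.

Lemma computable_has_all_sat (R : realFieldType) K (S : seq (seq (lin_constr K))) :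
  computable false (fun n (x : 'I_n -> 'I_K) =>
    has (fun cs => all (fun c => sat c (proportion R x)) cs) S).
Proof.
elim: S => [|cs S IHS] /=; first exact: computable_const.
apply: (computable_binop false orb) IHS.
elim: cs => [|c cs IHcs] /=; first exact: computable_const.
exact: (computable_binop false andb) (computable_sat R c) IHcs.
Qed.

(** * Assembly from the level sets *)

Theorem theorem3 (R : realFieldType) (K : nat) (Y : finType) (y0 : Y)
  (h : ('I_K -> R) -> Y) :
  rational_polyhedral_level_sets h -> computable_h y0 h.
Proof.
move=> level.
(* The finitely many values are treated one at a time, with [y0] as the answer outside the list [ys]
   covered so far. *)
suff partial (ys : seq Y) : computable y0 (fun n (x : 'I_n -> 'I_K) =>
    if h (proportion R x) \in ys then h (proportion R x) else y0).
  by apply: computable_ext (partial (enum Y)) => n x _; rewrite mem_enum.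
elim: ys => [|y ys IHys]; first exact: computable_const.
have [S levelS] := level y.
apply: computable_ext (computable_binop y0 (fun (b : bool) z => if b then y else z)
  (computable_has_all_sat R S) IHys) => n x n_gt0.
have hE := levelS _ (proportion_in_D R x n_gt0); rewrite in_cons.
case: eqP => [hy | hy].
  by rewrite (hE.1 hy) hy.
by case: ifP => // /hE.2.
Qed.
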